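(* Let $M\subset\mathbb{R}^d$ be a compact $C^2$ manifold, let $\phi\colon\mathbb{R}\times M\to M$ be a flow with $C^1$ velocity field $X$, and let $\Lambda\subset M$ be a compact $\phi$-invariant subset. If $\phi|_\Lambda$ is $k^*$-expansive and efficient, then $\phi|_\Lambda$ is rescaling expansive.
   Context: $\mathbb{R}^d$ carries the Euclidean norm $\|\cdot\|$, and the distance on $M$ (and $\Lambda$) is $\operatorname{dist}(x,y)=\|y-x\|$. $B(x,a)$ is the open ball of radius $a$ centered at $x$. $\operatorname{fix}(\phi)=\{\sigma:\phi_t(\sigma)=\sigma\ \forall t\in\mathbb{R}\}$. For $a,b\in\mathbb{R}$, $[a,b]$ denotes the closed interval of real numbers between $a$ and $b$, both for $a\le b$ and for $a>b$. For $I\subset\mathbb{R}$, $\phi_I(x)=\{\phi_t(x):t\in I\}$. $\mathcal{H}^+(\mathbb{R})$ is the set of all increasing homeomorphisms $h\colon\mathbb{R}\to\mathbb{R}$, and $\mathcal{H}^+_0(\mathbb{R})=\{h\in\mathcal{H}^+(\mathbb{R}):h(0)=0\}$. $\phi|_\Lambda$ is $k^*$-expansive if for all $\varepsilon>0$ there is $\delta>0$ such that if $x,y\in\Lambda$, $h\in\mathcal{H}^+_0(\mathbb{R})$ and $\operatorname{dist}(\phi_t(x),\phi_{h(t)}(y))\le\delta$ for all $t\in\mathbb{R}$, then $\phi_{h(t_0)}(y)\in\phi_{[-\varepsilon,\varepsilon]}(\phi_{t_0}(x))$ for some $t_0\in\mathbb{R}$. $\phi|_\Lambda$ is efficient if there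 is $\delta_*>0$ such that if $0<\delta<\delta_*$, $x\in\Lambda\setminus\operatorname{fix}(\phi)$ and $g\in\mathcal{H}^+(\mathbb{R})$ satisfy (i) $\operatorname{dist}(\phi_t(x),\phi_{g(t)}(x))<\delta\|X(\phi_t(x))\|$ for all $t\in\mathbb{R}$ and (ii) $\operatorname{diam}(\phi_{[t,g(t)]}(x))<\delta_*$ for all $t\in\mathbb{R}$, then $\phi_{[t,g(t)]}(x)\subset B(\phi_t(x),\delta\|X(\phi_t(x))\|)$ for all $t\in\mathbb{R}$. $\phi|_\Lambda$ is rescaling expansive if for all $\varepsilon>0$ there is $\delta>0$ such that if $x,y\in\Lambda$, $h\in\mathcal{H}^+_0(\mathbb{R})$ and $\operatorname{dist}(\phi_t(x),\phi_{h(t)}(y))\le\delta\|X(\phi_t(x))\|$ for all $t\in\mathbb{R}$, then $\phi_{h(t)}(y)\in\phi_{[-\varepsilon,\varepsilon]}(\phi_t(x))$ for all $t\in\mathbb{R}$. *)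

(* Defs.v *)
From HB Require Import structures.
From mathcomp Require Import all_boot all_order all_algebra.
From mathcomp Require Import all_classical all_reals all_analysis.
Set Implicit Arguments.
Unset Strict Implicit.
Unset Printing Implicit Defensive.
Import Order.TTheory GRing.Theory Num.Theory.
Import numFieldNormedType.Exports.
Local Open Scope classical_set_scope.
Local Open Scope ring_scope.

(* The library norm on 'rV[R]_d is the sup norm.  It is used below only through
   the topology and the differential calculus it induces, which are those of
   the Euclidean norm; every metric quantity uses [eucl_norm]. *)
Definition eucl_norm (R : realType) (d : nat) (x : 'rV[R]_d) : R :=
  Num.sqrt (\sum_(i < d) x 0 i ^+ 2).

Definition eucl_dist (R : realType) (d : nat) (x y : 'rV[R]_d) : R :=
  eucl_norm (y - x).

Definition eucl_ball (R : realType) (d : nat) (x : 'rV[R]_d) (a : R) :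
    set 'rV[R]_d :=
  [set y | eucl_dist x y < a].

(* Extended-real valued, because [sup] of an unbounded set of reals is 0. *)
Definition diam (R : realType) (d : nat) (A : set 'rV[R]_d) : \bar R :=
  ereal_sup [set (eucl_dist x y)%:E | x in A & y in A].

(* Meaningful for [U] open: f is of class C^r on U. *)
Fixpoint Cr_on (R : realType) (m n r : nat) (U : set 'rV[R]_m)
    (f : 'rV[R]_m -> 'rV[R]_n) : Prop :=
  if r is r'.+1 then
    (forall x, U x -> differentiable f x) /\
    (forall v : 'rV[R]_m, Cr_on r' U ('D_v f))
  else forall x, U x -> {for x, continuous f}.

(* A map defined on a subset of R^m is of class C^r if, near each point of the
   subset, it is the restriction of a C^r map defined on an open set. *)
Definition Cr_on_subset (R : realType) (m n r : nat) (M : set 'rV[R]_m)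
    (f : 'rV[R]_m -> 'rV[R]_n) : Prop :=
  forall p, M p -> exists (U : set 'rV[R]_m) (g : 'rV[R]_m -> 'rV[R]_n),
    [/\ open U, U p, Cr_on r U g & {in U `&` M, f =1 g}].

Definition Cr_diffeo (R : realType) (d r : nat) (U V : set 'rV[R]_d)
    (F G : 'rV[R]_d -> 'rV[R]_d) : Prop :=
  [/\ Cr_on r U F, Cr_on r V G,
      (forall x, U x -> V (F x) /\ G (F x) = x) &
      (forall y, V y -> U (G y) /\ F (G y) = y)].

(* Embedded k-dimensional C^r submanifold of R^d (without boundary): locally, a
   C^r diffeomorphism of open sets of R^d straightens M to R^k x {0}. *)
Definition Cr_submanifold (R : realType) (d r k : nat) (M : set 'rV[R]_d) :
    Prop :=
  (k <= d)%N /\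
  forall p, M p ->
    exists (U V : set 'rV[R]_d) (F G : 'rV[R]_d -> 'rV[R]_d),
      [/\ open U, U p, open V, Cr_diffeo r U V F G &
          forall x, U x ->
            (M x <-> forall i : 'I_d, (k <= i)%N -> F x 0 i = 0)].

(* A flow on M is a total function of which only the values on M matter. *)
Definition is_flow (R : realType) (d : nat) (M : set 'rV[R]_d)
    (phi : R -> 'rV[R]_d -> 'rV[R]_d) : Prop :=
  [/\ (forall t x, M x -> M (phi t x)),
      (forall x, M x -> phi 0 x = x),
      (forall s t x, M x -> phi (s + t) x = phi s (phi t x)) &
      {within [set: R] `*` M, continuous (fun p : R * 'rV[R]_d => phi p.1 p.2)}].

Definition velocity_field (R : realType) (d : nat) (M : set 'rV[R]_d)
    (phi : R -> 'rV[R]_d -> 'rV[R]_d) (X : 'rV[R]_d -> 'rV[R]_d) : Prop :=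
  forall x, M x -> is_derive (0 : R) (1 : R) (fun t : R => phi t x) (X x).

Definition flow_invariant (R : realType) (d : nat)
    (phi : R -> 'rV[R]_d -> 'rV[R]_d) (L : set 'rV[R]_d) : Prop :=
  forall t, phi t @` L = L.

Definition flow_fix (R : realType) (d : nat)
    (phi : R -> 'rV[R]_d -> 'rV[R]_d) : set 'rV[R]_d :=
  [set s | forall t, phi t s = s].

(* The closed interval between a and b, in either order. *)
Definition seg (R : realType) (a b : R) : set R :=
  `[Num.min a b, Num.max a b]%classic.

Definition flow_image (R : realType) (d : nat)
    (phi : R -> 'rV[R]_d -> 'rV[R]_d) (I : set R) (x : 'rV[R]_d) :
    set 'rV[R]_d :=
  [set phi t x | t in I].

Definition incr_homeo (R : realType) (h : R -> R) : Prop :=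
  [/\ {homo h : s t / s < t}, continuous h &
      exists g : R -> R, [/\ cancel h g, cancel g h & continuous g]].

Definition incr_homeo0 (R : realType) (h : R -> R) : Prop :=
  incr_homeo h /\ h 0 = 0.

Definition kstar_expansive (R : realType) (d : nat)
    (phi : R -> 'rV[R]_d -> 'rV[R]_d) (L : set 'rV[R]_d) : Prop :=
  forall eps : R, 0 < eps -> exists delta : R, 0 < delta /\
    forall (x y : 'rV[R]_d) (h : R -> R),
      L x -> L y -> incr_homeo0 h ->
      (forall t, eucl_dist (phi t x) (phi (h t) y) <= delta) ->
      exists t0 : R,
        flow_image phi (seg (- eps) eps) (phi t0 x) (phi (h t0) y).

Definition efficient (R : realType) (d : nat)
    (phi : R -> 'rV[R]_d -> 'rV[R]_d) (X : 'rV[R]_d -> 'rV[R]_d)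
    (L : set 'rV[R]_d) : Prop :=
  exists delta_s : R, 0 < delta_s /\
    forall (delta : R) (x : 'rV[R]_d) (g : R -> R),
      0 < delta < delta_s -> (L `\` flow_fix phi) x -> incr_homeo g ->
      (forall t, eucl_dist (phi t x) (phi (g t) x)
                   < delta * eucl_norm (X (phi t x))) ->
      (forall t, (diam (flow_image phi (seg t (g t)) x) < delta_s%:E)%E) ->
      forall t, flow_image phi (seg t (g t)) x `<=`
                eucl_ball (phi t x) (delta * eucl_norm (X (phi t x))).

Definition rescaling_expansive (R : realType) (d : nat)
    (phi : R -> 'rV[R]_d -> 'rV[R]_d) (X : 'rV[R]_d -> 'rV[R]_d)
    (L : set 'rV[R]_d) : Prop :=
  forall eps : R, 0 < eps -> exists delta : R, 0 < delta /\
    forall (x y : 'rV[R]_d) (h : R -> R),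
      L x -> L y -> incr_homeo0 h ->
      (forall t, eucl_dist (phi t x) (phi (h t) y)
                   <= delta * eucl_norm (X (phi t x))) ->
      forall t, flow_image phi (seg (- eps) eps) (phi t x) (phi (h t) y).

(* Main.v *)
(* As X is C^1 on the compact set M, it is Lipschitz, so that there is r > 0
   such that |phi_s p - p| >= |s| |X p| / 2 (in the sup norm) for all p in M and
   |s| <= r.  If phi_t x and phi_(h t) y are delta |X (phi_t x)|-close for all t,
   k*-expansivity with parameter r gives t0 with phi_(h t0) y = phi_(s0) (phi_t0 x)
   and |s0| <= r; hence phi_(h t) y = phi_(w t) (phi_t x) for all t, where
   w t = h t - h t0 + s0 + t0 - t is continuous and |w t0| <= r.  Whenever
   |w t| <= r, the lower bound on the displacement cancels X (phi_t x) <> 0 and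
   gives |w t| <= C delta < r.  By the intermediate value theorem |w| never
   leaves [0, C delta]. *)
Require Import Defs.
From HB Require Import structures.
From mathcomp Require Import all_boot all_order all_algebra.
From mathcomp Require Import all_classical all_reals all_analysis.
From mathcomp Require Import ring lra.
Import Order.TTheory GRing.Theory Num.Theory.
Import numFieldNormedType.Exports.
Local Open Scope classical_set_scope.
Local Open Scope ring_scope.

(** * Comparison of the sup norm with the Euclidean norm *)

Lemma coord_le_norm {R : realType} {d} (v : 'rV[R]_d) i : `|v 0 i| <= `|v|.
Proof.
by rewrite [leRHS]/Num.Def.normr/= mx_normrE; apply: (le_bigmax _ _ (0, i)).
Qed.

Lemma rV_norm_le {R : realType} {d} (v : 'rV[R]_d) (a : R) :
  0 <= a -> (forall i, `|v 0 i| <= a) -> `|v| <= a.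
Proof.
move=> a0 va; rewrite /Num.Def.normr/= mx_normrE; apply: bigmax_le => // -[i j] _ /=.
by rewrite ord1.
Qed.

Lemma norm_le_eucl_norm {R : realType} {d} (v : 'rV[R]_d) : `|v| <= eucl_norm v.
Proof.
apply: rV_norm_le => [|i]; first exact: sqrtr_ge0.
rewrite -sqrtr_sqr; apply: ler_wsqrtr.
by rewrite (bigD1 i)//= lerDl; apply: sumr_ge0 => j _; exact: sqr_ge0.
Qed.

(** The factor [d.+1] is cruder than the square root of [d], but it is positive even for [d = 0], so
    it can later be divided by. *)
Lemma eucl_norm_le_norm {R : realType} {d} (v : 'rV[R]_d) :
  eucl_norm v <= d.+1%:R * `|v|.
Proof.
rewrite -(ler_pXn2r (n := 2))// ?nnegrE ?sqrtr_ge0 ?mulr_ge0//.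
rewrite sqr_sqrtr; last by apply: sumr_ge0 => j _; exact: sqr_ge0.
apply: (@le_trans _ _ (\sum_(i < d) `|v| ^+ 2)).
  apply: ler_sum => i _; rewrite -real_normK ?num_real//.
  by rewrite ler_pXn2r// ?nnegrE// coord_le_norm.
rewrite sumr_const card_ord -[leLHS]mulr_natl exprMn ler_wpM2r ?sqr_ge0//.
by rewrite -natrX ler_nat (leq_trans (leqnSn d))// leq_pmulr.
Qed.

(** * Coordinatewise mean values and Lipschitz bounds for C^1 maps *)

Lemma is_derive_coord {R : realType} {d} (f : R -> 'rV[R]_d) (t : R) (df : 'rV[R]_d)
    (i : 'I_d) :
  is_derive t 1 f df -> is_derive t 1 (fun s => f s 0 i) (df 0 i).
Proof.
move=> [fd <-]; split; first by have /derivable_mxP := fd; apply.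
by rewrite (derive_mx fd) mxE.
Qed.

(** The mean value equality fails for vector-valued curves, so the intermediate point depends on the
    coordinate [i]; this is enough for bounds in the sup norm. *)
Lemma coord_MVT {R : realType} {d} (f df : R -> 'rV[R]_d) (a b : R) (i : 'I_d) :
  (forall t, seg a b t -> is_derive t 1 f (df t)) ->
  exists2 c, seg a b c & (f b - f a) 0 i = (b - a) * df c 0 i.
Proof.
wlog ab : a b / a <= b => [hw fd|].
  have [/hw|/ltW ba] := leP a b; first exact.
  have segC : seg b a = seg a b by rewrite /seg minC maxC.
  have fd' t : seg b a t -> is_derive t 1 f (df t) by rewrite segC; exact: fd.
  have [c cab e] := hw b a ba fd'.
  exists c; first by rewrite -segC.
  by rewrite -opprB mxE e -mulNr opprB.
rewrite /seg min_l// max_r// => fd.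
have fi t : t \in `[a, b]%R -> is_derive t 1 (fun s => f s 0 i) (df t 0 i).
  by move=> tab; apply: is_derive_coord; apply: fd.
have fi' t : t \in `]a, b[%R -> is_derive t 1 (fun s => f s 0 i) (df t 0 i).
  by move=> /subset_itv_oo_cc; exact: fi.
have fc : {within `[a, b], continuous (fun s => f s 0 i)}.
  by apply: derivable_within_continuous => t /fi [].
have [c cab e] := MVT_segment ab fi' fc.
by exists c; rewrite // !mxE e mulrC.
Qed.

Lemma is_derive_line {R : realType} {m n} (g : 'rV[R]_m -> 'rV[R]_n)
    (x v : 'rV[R]_m) (t : R) :
  differentiable g (t *: v + x) ->
  is_derive t 1 (fun s : R => g (s *: v + x)) ('D_v g (t *: v + x)).
Proof.
move=> /diff_derivable - /(_ v) gd.
have E : (fun h : R => h^-1 *: (((fun s : R => g (s *: v + x)) \o shift t) (h *: 1) -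
    g (t *: v + x))) =
    (fun h : R => h^-1 *: ((g \o shift (t *: v + x)) (h *: v) - g (t *: v + x))).
  by apply/funext => h /=; rewrite [h *: 1]mulr1 scalerDl addrA.
by split; rewrite /derivable /derive E.
Qed.

(** [Cr_on] gives continuity of ['D_v g] for each [v] separately. Uniformity in [v] comes from
    linearity of the differential: only the finitely many basis directions need a local bound. *)
Lemma derive_bound_near {R : realType} {m n} (g : 'rV[R]_m -> 'rV[R]_n)
    (U : set 'rV[R]_m) (p : 'rV[R]_m) :
  open U -> U p -> Cr_on 1 U g ->
  exists B : R, 0 <= B /\ \forall z \near p, forall v, `|'D_v g z| <= B * `|v|.
Proof.
move=> oU Up [gd gc].
pose b j := `|'D_(delta_mx 0 j) g p| + 1.
exists (\sum_j b j); split; first by apply: sumr_ge0 => j _; rewrite addr_ge0.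
have nb : \forall z \near p, forall j, `|'D_(delta_mx 0 j) g z| <= b j.
  apply: (filter_forall (nbhs_filter p)) => j.
  have /cvgrPdist_le/(_ 1 ltr01) := gc (delta_mx 0 j) p Up.
  apply: filterS => z; rewrite distrC /b.
  set u := 'D_ _ g z; set w := 'D_ _ g p => uw.
  by rewrite -(subrK w u) (le_trans (ler_normD _ _))// addrC lerD2l.
near=> z => v.
have gz : differentiable g z by apply: gd; near: z; exact: open_nbhs_nbhs.
have zb : forall j, `|'D_(delta_mx 0 j) g z| <= b j by near: z.
rewrite deriveE// [v in 'd g z v]row_sum_delta linear_sum.
rewrite (le_trans (ler_norm_sum _ _ _))// mulr_suml; apply: ler_sum => j _.
rewrite linearZ normrZ mulrC ler_pM ?coord_le_norm//.
by rewrite -deriveE.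
Unshelve. all: by end_near. Qed.

(** The segment from [x] to [y] may leave [M], but it stays in a ball on which the local extension
    [g] is C^1, and the mean value theorem is applied to [g] there. *)
Lemma C1_locally_lipschitz {R : realType} {m n} (M : set 'rV[R]_m)
    (f : 'rV[R]_m -> 'rV[R]_n) (p : 'rV[R]_m) :
  Cr_on_subset 1 M f -> M p ->
  exists r B : R, [/\ 0 < r, 0 <= B & forall x y, M x -> M y ->
    `|x - p| < r -> `|y - p| < r -> `|f y - f x| <= B * `|y - x|].
Proof.
move=> fC1 Mp; have [U [g [oU Up gC1 gf]]] := fC1 p Mp.
have [B [B0 gB]] := derive_bound_near _ _ _ oU Up gC1.
have /nbhs_ballP[r /= r0 pr] : \forall z \near p, U z /\ forall v, `|'D_v g z| <= B * `|v|.
  by apply: filterI => //; exact: open_nbhs_nbhs.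
exists r, B; split=> // x y Mx My xr yr.
have ballP z : `|z - p| < r -> U z /\ forall v, `|'D_v g z| <= B * `|v|.
  by move=> zr; apply: pr; rewrite -ball_normE /= distrC.
have UM z : M z -> `|z - p| < r -> z \in U `&` M.
  by move=> Mz /ballP[Uz _]; rewrite inE.
rewrite !gf ?UM//.
have seg_ball t : seg 0 1 t -> `|t *: (y - x) + x - p| < r.
  rewrite /seg min_l// max_r//= in_itv/= => /andP[t0 t1].
  have -> : t *: (y - x) + x - p = t *: (y - p) + (1 - t) *: (x - p).
    by apply/matrixP => i j; rewrite !mxE; ring.
  rewrite (le_lt_trans (ler_normD _ _))// !normrZ (ger0_norm t0) ger0_norm ?subr_ge0//.
  (* For [t > 0] the strictness comes from [y]; for [t = 0] it has to come from [x]. *)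
  have [->|tN0] := eqVneq t 0; first by rewrite mul0r add0r subr0 mul1r.
  have tp : 0 < t by rewrite lt_def tN0.
  nra.
apply: rV_norm_le => [|i]; first by rewrite mulr_ge0.
have gd t : seg 0 1 t -> is_derive t 1 (fun s : R => g (s *: (y - x) + x))
    ('D_(y - x) g (t *: (y - x) + x)).
  by move=> /seg_ball/ballP[Ut _]; apply: is_derive_line; exact: gC1.1.
have [c /seg_ball/ballP[_ cB]] := coord_MVT _ _ _ _ i gd.
rewrite scale1r scale0r add0r subrK subr0 mul1r => ->.
by rewrite (le_trans (coord_le_norm _ _)).
Qed.

Lemma C1_compact_lipschitz {R : realType} {m n} (M : set 'rV[R]_m)
    (f : 'rV[R]_m -> 'rV[R]_n) :
  compact M -> Cr_on_subset 1 M f ->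
  exists A : R, [/\ 0 < A, forall x, M x -> `|f x| <= A &
    forall x y, M x -> M y -> `|f y - f x| <= A * `|y - x|].
Proof.
move=> /compact_near_coveringP cM fC1.
(* A single parameter [A] serves as bound, Lipschitz constant and inverse of the scale, so that
   compactness yields one value valid on all of [M]. *)
pose P (A : R) x := (M x -> `|f x| <= A) /\
  forall y, M x -> M y -> `|y - x| < A^-1 -> `|f y - f x| <= A * `|y - x|.
have [A [A0 AP]] : exists A : R, 0 < A /\ M `<=` P A.
  have := @cM R +oo%R P _ => /(_ _)[].
    move=> p Mp; have [r [B [r0 B0 rB]]] := C1_locally_lipschitz _ _ _ fC1 Mp.
    near=> x A.
    (* Since [A^-1 <= r / 2], both [x] and any [y] within [A^-1] of it lie in the ball of radius [r]
       about [p]. *)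
    have xp : `|x - p| < r / 2.
      by rewrite distrC; near: x; apply: cvgr_dist_lt; rewrite ?divr_gt0.
    have AB : B <= A by near: A; apply: nbhs_pinfty_ge; rewrite num_real.
    have Ar : 2 / r <= A by near: A; apply: nbhs_pinfty_ge; rewrite num_real.
    have Af : `|f p| + B * r <= A by near: A; apply: nbhs_pinfty_ge; rewrite num_real.
    have xr : `|x - p| < r by lra.
    split=> [Mx|y Mx My yx].
      rewrite -(subrK (f p) (f x)) (le_trans (ler_normD _ _))//.
      rewrite (le_trans _ Af)// addrC lerD2l (le_trans (rB p x Mp Mx _ xr))//.
        by rewrite subrr normr0.
      by rewrite ler_wpM2l// ltW.
    have yx' : `|y - x| < r / 2.
      rewrite (lt_le_trans yx)// -(invf_div 2 r) lef_pV2// posrE ?divr_gt0//.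
      by rewrite (lt_le_trans _ Ar)// divr_gt0.
    have yr : `|y - p| < r.
      by rewrite -(subrKA x) (le_lt_trans (ler_normD _ _))//; lra.
    by rewrite (le_trans (rB _ _ Mx My xr yr))// ler_wpM2r.
  move=> c [_ cP]; exists (Num.max (c + 1) 1); split; first by rewrite lt_max ltr01 orbT.
  by apply: cP; rewrite lt_max ltrDl ltr01.
exists (A + 2 * A ^+ 2); split.
- by rewrite addr_gt0// mulr_gt0// exprn_gt0.
- by move=> x Mx; rewrite (le_trans ((AP x Mx).1 Mx))// lerDl mulr_ge0// sqr_ge0.
- move=> x y Mx My; rewrite mulrDl.
  have [yx|yx] := ltP `|y - x| A^-1.
    by rewrite (le_trans ((AP x Mx).2 y Mx My yx))// lerDl !mulr_ge0// ltW.
  (* For points at least [A^-1] apart, the sup bound suffices: the difference of values is at most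
     [2 * A], hence at most [2 * A ^+ 2] times the distance. *)
  have Ay : 1 <= A * `|y - x| by rewrite mulrC -ler_pdivrMr// div1r.
  have := ler_normB (f y) (f x).
  have := (AP x Mx).1 Mx; have := (AP y My).1 My.
  by nra.
Unshelve. all: by end_near. Qed.

(** * Short-time displacement along the flow *)

Lemma is_derive_flow {R : realType} {d} {M : set 'rV[R]_d} {phi X} (p : 'rV[R]_d) (t : R) :
  is_flow M phi -> velocity_field M phi X -> M p ->
  is_derive t 1 (fun s : R => phi s p) (X (phi t p)).
Proof.
move=> [phiM phi0 phiD _] vX Mp; have [dt <-] := vX _ (phiM t _ Mp).
have E : (fun h : R => h^-1 *: (((fun s => phi s p) \o shift t) (h *: 1) - phi t p)) =
    (fun h : R => h^-1 *: (((fun s => phi s (phi t p)) \o shift 0) (h *: 1)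
      - phi 0 (phi t p))).
  by apply/funext => h /=; rewrite addr0 phiD// phi0//; exact: phiM.
by split; rewrite /derivable /derive E.
Qed.

(** Let [u c] be the largest displacement over times in [[-|s|, |s|]]. As [X] is Lipschitz, the
    orbit deviates from the line [p + t X p] by at most [u c / 4]. At time [c] this bounds [u c] by
    [4/3] of [|s| |X p|]; at time [s] it then gives the lower bound. *)
Lemma flow_displacement {R : realType} {d} {M : set 'rV[R]_d} {phi X} {K : R}
    (p : 'rV[R]_d) (s : R) :
  is_flow M phi -> velocity_field M phi X -> M p -> 0 < K ->
  (forall x y, M x -> M y -> `|X y - X x| <= K * `|y - x|) ->
  `|s| * K <= 4^-1 ->
  `|s| * `|X p| <= 2 * `|phi s p - p| /\ `|phi s p - p| <= 2 * (`|s| * `|X p|).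
Proof.
move=> phiF vX Mp K0 XK sK; have [phiM phi0 _ _] := phiF.
have dphi t := is_derive_flow p t phiF vX Mp.
pose u t := `|phi t p - p|.
have uc : {within `[- `|s|, `|s|], continuous u}.
  apply: continuous_subspaceT => t.
  apply: continuous_comp; last exact: norm_continuous.
  apply: cvgB; last exact: cvg_cst.
  by apply/differentiable_continuous/derivable1_diffP; case: (dphi t).
have [|c cs cmax] := EVT_max _ uc; first by rewrite ge0_cp.
have uc0 : 0 <= u c by exact: normr_ge0.
have dev t : `|t| <= `|s| -> `|phi t p - p - t *: X p| <= `|t| * (K * u c).
  move=> ts; apply: rV_norm_le => [|i]; first by rewrite mulr_ge0// mulr_ge0// ltW.
  have [e e0t eE] := coord_MVT _ _ 0 t i (fun t _ => dphi t).
  rewrite phi0// subr0 in eE.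
  have -> : (phi t p - p - t *: X p) 0 i = t * (X (phi e p) - X p) 0 i.
    by rewrite mxE eE !mxE mulrBr.
  rewrite normrM ler_wpM2l// (le_trans (coord_le_norm _ _))//.
  rewrite (le_trans (XK _ _ Mp (phiM e _ Mp)))// (ler_wpM2l (ltW K0))// cmax//.
  rewrite in_itv/= -ler_norml (le_trans _ ts)//.
  move: e0t; rewrite /seg/= in_itv/= ler_norml.
  have := ler_norm t; have := ler_norm (- t); rewrite normrN.
  by case: (lerP 0 t) => t0 ? ? /andP[]; lra.
have cs' : `|c| <= `|s| by move: cs; rewrite in_itv/= ler_norml.
have X0 := normr_ge0 (X p);
have us := cmax s; rewrite in_itv/= -ler_norml lexx in us; have {}us := us isT.
have dc : `|c| * (K * u c) <= 4^-1 * u c.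
  by rewrite mulrA ler_wpM2r// (le_trans _ sK)// ler_wpM2r// ltW.
have ds : `|s| * (K * u c) <= 4^-1 * u c by rewrite mulrA ler_wpM2r.
have uc_le : u c <= `|s| * `|X p| + 4^-1 * u c.
  rewrite /u -{1}(subrK (c *: X p) (phi c p - p)).
  rewrite (le_trans (ler_normD _ _))// normrZ addrC lerD ?ler_wpM2r//.
  by rewrite (le_trans (dev _ cs')).
have us_ge : `|s| * `|X p| <= u s + 4^-1 * u c.
  rewrite -normrZ -[s *: _](subKr (phi s p - p)) (le_trans (ler_normB _ _))//.
  by rewrite lerD// (le_trans (dev _ (lexx _))).
rewrite -/(u s); split; lra.
Qed.

(** The upper displacement bound fixes [p] for all short times, and every time is an integer
    multiple of a short one. *)
Lemma velocity0_fix {R : realType} {d} {M : set 'rV[R]_d} {phi X} {K : R}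
    (p : 'rV[R]_d) :
  is_flow M phi -> velocity_field M phi X -> M p -> 0 < K ->
  (forall x y, M x -> M y -> `|X y - X x| <= K * `|y - x|) ->
  X p = 0 -> flow_fix phi p.
Proof.
move=> phiF vX Mp K0 XK Xp0 t; have [_ phi0 phiD _] := phiF.
have fix_small s : `|s| * K <= 4^-1 -> phi s p = p.
  move=> sK; have [_] := flow_displacement p s phiF vX Mp K0 XK sK.
  by rewrite Xp0 normr0 !mulr0 normr_le0 subr_eq0 => /eqP.
(* Since [n.+1] exceeds [4 * K * |t|], the step [s] satisfies [|s| * K <= 1/4]. *)
pose n := Num.truncn (4 * K * `|t|); pose s := t / n.+1%:R.
have ss : phi s p = p.
  apply: fix_small; rewrite normrM normfV normr_nat mulrAC ler_pdivrMr//.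
  by have := truncnS_gt (4 * K * `|t|); rewrite -/n; lra.
have -> : t = s *+ n.+1 by rewrite -mulr_natr divfK.
elim: n.+1 => [|m IH]; first by rewrite mulr0n phi0.
by rewrite mulrS phiD// IH.
Qed.

(** The values of [f] avoid the gap between [a] and [b]; a value above [b] would force the midpoint
    [(a + b) / 2] to be attained. *)
Lemma continuous_gap {R : realType} (f : R -> R) (a b t0 : R) :
  continuous f -> a < b -> (forall t, f t <= b -> f t <= a) -> f t0 <= b ->
  forall t, f t <= a.
Proof.
move=> fc ab gap ft0 t; have t0a := gap t0 ft0.
rewrite (gap t)// leNgt; apply/negP => bt; have a_b : a < (a + b) / 2 < b by lra.
have fw u v : {within `[u, v], continuous f} by exact: continuous_subspaceT.
have [c fcE] : exists c, f c = (a + b) / 2.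
  have [tt|/ltW tt] := leP t0 t.
    have [|c _ <-] := IVT (v := (a + b) / 2) tt (fw _ _); last by exists c.
    by rewrite ge_min le_max; lra.
  have [|c _ <-] := IVT (v := (a + b) / 2) tt (fw _ _); last by exists c.
  by rewrite ge_min le_max; lra.
by have := gap c; rewrite fcE; lra.
Qed.

Theorem theorem3p23 (R : realType) (d k : nat) (M : set 'rV[R]_d)
    (phi : R -> 'rV[R]_d -> 'rV[R]_d) (X : 'rV[R]_d -> 'rV[R]_d)
    (L : set 'rV[R]_d)
    (M_compact : compact M) (M_manifold : Cr_submanifold 2 k M)
    (phi_flow : is_flow M phi)
    (X_velocity : velocity_field M phi X) (X_C1 : Cr_on_subset 1 M X)
    (L_sub : L `<=` M) (L_compact : compact L)
    (L_inv : flow_invariant phi L) :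
  kstar_expansive phi L -> efficient phi X L -> rescaling_expansive phi X L.
Proof.
move=> phi_exp _ eps eps0; have [phiM phi0 phiD _] := phi_flow.
have [A [A0 XA XK]] := C1_compact_lipschitz _ _ M_compact X_C1.
(* The longest time for which [flow_displacement] applies with Lipschitz constant [A]. *)
pose r := (4 * A)^-1; have r0 : 0 < r by rewrite invr_gt0 mulr_gt0.
pose D : R := d.+1%:R; have D0 : 0 < D by rewrite ltr0n.
have [delta1 [delta10 exp1]] := phi_exp r r0.
(* The target bound on the time shift: [eps] serves the conclusion, and [r / 2] keeps [c < r], so
   that there is a gap to exploit. *)
pose c := Num.min eps (r / 2).
(* The first term turns rescaled closeness into [delta1]-closeness, as [X] is bounded by [A]; the
   second absorbs the factor 2 of the displacement bound. [D] pays for the change of norm. *)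
pose delta := Num.min (delta1 / (D * A)) (c / (2 * D)).
have c0 : 0 < c by rewrite lt_min eps0 divr_gt0.
have delta0 : 0 < delta by rewrite lt_min !divr_gt0 ?mulr_gt0.
have delta_c : 2 * (delta * D) <= c.
  by rewrite mulrCA -ler_pdivlMr ?mulr_gt0// ge_min lexx orbT.
have delta_exp : delta * D * A <= delta1.
  by rewrite -mulrA -ler_pdivlMr ?mulr_gt0// ge_min lexx.
exists delta; split=> // x y h Lx Ly h0 close.
have Mx := L_sub x Lx; have My := L_sub y Ly.
have speed t : delta * eucl_norm (X (phi t x)) <= delta * D * `|X (phi t x)|.
  by rewrite -mulrA ler_wpM2l ?eucl_norm_le_norm// ltW.
have near t : `|phi (h t) y - phi t x| <= delta * D * `|X (phi t x)|.
  by rewrite (le_trans (norm_le_eucl_norm _))// (le_trans (close t)).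
(* At a zero of [X] the point [x] is fixed and the allowed distance is 0, so the orbit of [y] stays
   at [x] and the time shift 0 works. *)
have [Xx0 t|Xx_neq0] := eqVneq (X x) 0.
  have xfix := velocity0_fix x phi_flow X_velocity Mx A0 XK Xx0.
  exists 0; first by rewrite /seg/= in_itv/= ge_min le_max; lra.
  have := near t; rewrite xfix Xx0 normr0 mulr0 normr_le0 subr_eq0 => /eqP ->.
  by rewrite phi0.
(* A zero of [X] at [phi t x] would make that point fixed; flowing back for time [t] would identify
   it with [x]. *)
have X_neq0 t : X (phi t x) != 0.
  apply: contra_neq Xx_neq0 => Xt0.
  have := velocity0_fix _ phi_flow X_velocity (phiM t x Mx) A0 XK Xt0.
  by move=> /(_ (- t)); rewrite -phiD// addNr phi0// => ->.
have [t0 [s0 s0r s0E]] : exists t0 : R,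
    flow_image phi (seg (- r) r) (phi t0 x) (phi (h t0) y).
  apply: exp1 => // t; rewrite (le_trans (close t))// (le_trans (speed t))//.
  rewrite (le_trans _ delta_exp)// ler_wpM2l ?mulr_ge0 ?(ltW delta0)//.
  exact/XA/phiM.
pose w t := h t - h t0 + s0 + t0 - t.
(* Flow from [phi (h t0) y] for time [h t - h t0], replace that point by [phi s0 (phi t0 x)], and
   collect the times by the group law. *)
have wE t : phi (h t) y = phi (w t) (phi t x).
  rewrite -(subrK (h t0) (h t)) phiD// -s0E -!phiD//; last exact: phiM.
  by congr (phi _ x); rewrite /w; ring.
have s0_le : `|s0| <= r.
  by move: s0r; rewrite /seg/= in_itv/= ge_min le_max ler_norml; lra.
have w_le : forall t, `|w t| <= c.
  apply: (continuous_gap (fun t => `|w t|) c r t0).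
  - move=> t; apply: continuous_comp; last exact: norm_continuous.
    have [[_ hc _] _] := h0.
    apply: continuousB; last exact: cvg_id.
    by do 3! (apply: continuousD; last exact: cvg_cst); exact: hc.
  - by rewrite gt_min; lra.
  - move=> t wr; have wA : `|w t| * A <= 4^-1.
      by rewrite (le_trans (ler_wpM2r (ltW A0) wr))// /r invfM divfK// gt_eqF.
    have [wX _] := flow_displacement _ (w t) phi_flow X_velocity (phiM t x Mx) A0 XK wA.
    rewrite -(ler_pM2r (x := `|X (phi t x)|)) ?normr_gt0// (le_trans wX)//.
    rewrite -wE (le_trans _ (ler_wpM2r _ delta_c))//.
    by rewrite -mulrA ler_wpM2l.
  - by rewrite /w subrr add0r addrK.
move=> t; exists (w t); last by rewrite wE.
have := w_le t; rewrite /c le_min ler_norml /seg/= in_itv/=.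
by rewrite ge_min le_max => /andP[/andP[-> ->] _]; rewrite orbT.
Qed.
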